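(* There exists a universal constant $C>0$ such that the following holds. Let $n\in\mathbb{N}$, let $q$ be a prime power, let $\ell<q$ be a positive integer, let $\rho\in(0,1-\ell/q)$, and let $\varepsilon\in(0,1)$. Suppose $n\ge\left(\frac{\log q}{\rho(1-\ell/q-\rho)}\right)^{C}$. Then there is a quantity $C_{\rho,\ell,q}\le q^{\ell\cdot\left(\frac{\log q}{\rho(1-\ell/q-\rho)}\right)^{C}}$ such that, with probability at least $1-q^{-n}$, a random linear code $\mathcal{C}\subseteq\mathbb{F}_q^n$ of rate $R=1-h_{q,\ell}(\rho)-\varepsilon$ is $(\rho,\ell,L)$-list-recoverable from errors with $L=C_{\rho,\ell,q}\cdot\frac{1}{\varepsilon}$.
   Context: $\log$ denotes the base-2 logarithm. For integers $1\le\ell<q$ and $x\in(0,1)$, $h_{q,\ell}(x)=x\log_q\frac{q-\ell}{x}+(1-x)\log_q\frac{\ell}{1-x}$. A random linear code $\mathcal{C}\subseteq\mathbb{F}_q^n$ of rate $R$ is obtained by sampling a uniformly random matrix $H\in\mathbb{F}_q^{(1-R)n\times n}$ and setting $\mathcal{C}=\{x: Hx=0\}$. For $T_1,\dots,T_n\subseteq\mathbb{F}_q$, the list-recovery ball is $B_\rho(T_1\times\cdots\times T_n)=\{x\in\mathbb{F}_q^n: |\{i: x_i\notin T_i\}|\le\rho n\}$. A code $\mathcal{C}$ is $(\rho,\ell,L)$-list-recoverable from errors if for all $T_1,\dots,T_n\subseteq\mathbb{F}_q$ with $|T_i|\le\ell$ for all $i$, $|\mathcal{C}\cap B_\rho(T_1\times\cdots\times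 T_n)|\le L$. *)

(* Defs.v *)
From Stdlib Require Import Reals.
From mathcomp Require Import all_boot all_algebra.
Set Implicit Arguments. Unset Strict Implicit. Unset Printing Implicit Defensive.

Local Open Scope R_scope.

Definition log2 (x : R) : R := ln x / ln 2.
Definition logb (b x : R) : R := ln x / ln b.

Definition hql (q l : nat) (x : R) : R :=
  x * logb (INR q) ((INR q - INR l) / x)
  + (1 - x) * logb (INR q) (INR l / (1 - x)).

(** ceiling of a real, as a natural number (0 for negative inputs) *)
Definition ceil_nat (x : R) : nat := Z.to_nat (- Int_part (- x)).

Definition Rleb (x y : R) : bool := if Rle_dec x y then true else false.

Definition prime_power (q : nat) : Prop :=
  exists p k : nat, prime p /\ (0 < k)%N /\ q = (p ^ k)%N.

Definition kernel_code (F : finFieldType) (m n : nat) (H : 'M[F]_(m, n))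
  : {set 'cV[F]_n} := [set x | (H *m x == 0)%R].

Definition lr_ball (F : finFieldType) (n : nat) (rho : R) (T : 'I_n -> {set F})
  : {set 'cV[F]_n} :=
  [set x : 'cV[F]_n | Rleb (INR #|[set i : 'I_n | x i ord0 \notin T i]|) (rho * INR n)].

Definition list_recoverable (F : finFieldType) (n : nat) (C : {set 'cV[F]_n})
  (rho : R) (l : nat) (L : R) : Prop :=
  forall T : 'I_n -> {set F}, (forall i, (#|T i| <= l)%N) ->
    INR #|C :&: lr_ball rho T| <= L.

(* Main.v *)
Require Import Defs.
From Stdlib Require Import Reals Lra ZArith.
From mathcomp Require Import all_boot all_order all_algebra.
From mathcomp Require Import zify Rstruct.
Set Implicit Arguments. Unset Strict Implicit. Unset Printing Implicit Defensive.
Import Order.TTheory GRing.Theory Num.Theory.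

(** The expected number of codewords in a ball is at most [q ^ (- eps n)], so [t]
    linearly independent codewords lie in it with probability [q ^ (- eps n t)],
    which beats the union bound over the [q ^ (l n)] choices of the sets [T i] once
    [t] is of order [l / eps]. It remains to see that fewer than [t] independent
    vectors of a ball [B] rarely span more than [C t] points of [B] (Guruswami,
    Hastad and Kopparty). A set of more than [C t] coefficient vectors has a
    translate containing a chain of length [d], of order [log C / log q], each
    member of which is nonzero at two coordinates where the later ones vanish.
    Replace the uniform law on [B] by the product law giving each symbol of [T i]
    mass [(1 - rho) / l] and each other one mass [rho / (q - l)]: it costs
    nothing, because a point of [B] has mass at least [q ^ (- h n)]. Along the
    chain, each step then adds two fresh independent symbols, and the sum
    [al * a + be * b + z] falls in [T i] with probability at most
    [1 - rho - rho * (1 - l / q - rho)], so each step has an exponentially small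
    probability, uniformly in the previous ones.

    The argument needs [t] to be a small fraction of [n], that is [eps] at least a
    large constant over [n]. Otherwise one adds [s] random parity checks: the list
    shrinks on average by the constant factor [q ^ s], and the gap to capacity
    grows by [s / n]. *)

Local Open Scope ring_scope.

(** * Increasing chains and moments of random rows *)

Lemma pigeonhole_fiber (T : finType) (F : finType) (A : {set T}) (f : T -> F) :
  (0 < #|F|)%N -> exists a, (#|A| <= #|F| * #|[set x in A | f x == a]|)%N.
Proof.
move=> /card_gt0P [a0 _].
exists [arg max_(a > a0) #|[set x in A | f x == a]|].
case: arg_maxnP => // a _ amax.
rewrite -sum1_card (partition_big f predT) //= -sum_nat_const.
by apply: leq_sum => b _; rewrite sum1dep_card; apply: amax.
Qed.

Section Chains.
Variable F : finFieldType.

Definition row_update (t : nat) (x : 'rV[F]_t) (i : 'I_t) (a : F) : 'rV[F]_t :=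
  \row_k if k == i then a else x 0 k.

(** The head owns the two fresh coordinates: changing a vector there leaves its products with the
    whole tail unchanged, so an induction can peel off the head. *)
Fixpoint increasing_chain (t : nat) (us : seq 'rV[F]_t) : bool :=
  if us is u :: us' then
    [exists i, exists j, [&& i != j, u 0 i != 0, u 0 j != 0
      & all (fun v : 'rV[F]_t => (v 0 i == 0) && (v 0 j == 0)) us']]
    && increasing_chain us'
  else true.

(** At most [#|F| * t + 1] rows differ from [a] in at most one coordinate: [a] itself, and one row
    for each choice of a coordinate and a new value. The map [f] lists them. *)
Lemma row_far_from_center (t : nat) (S : {set 'rV[F]_t}) (a : 'rV[F]_t) :
  (#|F| * t + 1 < #|S|)%N ->
  exists v i j, [/\ v \in S, i != j, v 0 i != a 0 i & v 0 j != a 0 j].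
Proof.
move=> ltS.
pose f (o : option ('I_t * F)) := if o is Some (i, c) then row_update a i c else a.
have /subsetPn [v vS vnf] : ~~ (S \subset [set f o | o in setT]).
  apply: contraL ltS => /subset_leq_card leS; rewrite -leqNgt.
  apply: leq_trans leS _; apply: leq_trans (leq_imset_card _ _) _.
  by rewrite cardsT card_option card_prod card_ord mulnC addn1.
have [i vi] : exists i, v 0 i != a 0 i.
  apply/existsP; apply: contraR vnf; rewrite negb_exists => /forallP eqva.
  apply/imsetP; exists None => //; apply/rowP=> k.
  by move: (eqva k); rewrite negbK => /eqP.
have [j /andP [ji vj]] : exists j, (j != i) && (v 0 j != a 0 j).
  apply/existsP; apply: contraR vnf; rewrite negb_exists => /forallP eqva.
  apply/imsetP; exists (Some (i, v 0 i)) => //; apply/rowP=> k; rewrite mxE.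
  by have [->//|neq_ki] := eqVneq k i; move: (eqva k); rewrite neq_ki negbK => /eqP.
by exists v, i, j; rewrite eq_sym.
Qed.

(* If the most popular completions of the plurality values at [i] and [j]
   happen to be the entries of [v], these two completions already differ
   in both coordinates and [v] is not needed. *)
Lemma popular_pair_step (t : nat) (S : {set 'rV[F]_t}) :
  (#|F| * t + 1 < #|S|)%N ->
  exists i j a b v, [/\ i != j, v \in S, v 0 i != a, v 0 j != b
    & (#|S| <= #|F| ^ 2 * #|[set x in S | (x 0%R i == a) && (x 0%R j == b)]|)%N].
Proof.
move=> ltS.
have F0 : (0 < #|F|)%N by apply/card_gt0P; exists 0.
have ex_a (k : 'I_t) : exists c, (#|S| <= #|F| * #|[set x in S | x 0%R k == c]|)%N.
  exact: (pigeonhole_fiber S (fun x : 'rV_t => x 0 k)).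
pose a : 'rV[F]_t := \row_k xchoose (ex_a k).
have aP k : (#|S| <= #|F| * #|[set x in S | x 0%R k == a 0%R k]|)%N.
  by rewrite mxE; apply: (xchooseP (ex_a k)).
have [v [i [j [vS ij vi vj]]]] := row_far_from_center a ltS.
have pair (k k' : 'I_t) : exists b, (#|S| <=
    #|F| ^ 2 * #|[set x in S | (x 0%R k == a 0%R k) && (x 0%R k' == b)]|)%N.
  have [b leb] := pigeonhole_fiber [set x in S | x 0 k == a 0 k]
    (fun x : 'rV_t => x 0 k') F0.
  exists b; apply: leq_trans (aP k) _; rewrite expnS expn1 -mulnA leq_mul2l.
  apply/orP; right; apply: leq_trans leb _; rewrite leq_mul2l; apply/orP; right.
  by apply: subset_leq_card; apply/subsetP=> x; rewrite !inE andbA.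
have [b leb] := pair i j; have [c lec] := pair j i.
have [eqb|neqb] := eqVneq (v 0 j) b; last by exists i, j, (a 0 i), b, v.
have [eqc|neqc] := eqVneq (v 0 i) c; last first.
  exists j, i, (a 0 j), c, v; split=> //; by rewrite eq_sym.
have [y] : exists y, y \in [set x in S | (x 0 j == a 0 j) && (x 0 i == c)].
  apply/set0Pn; apply/negP=> /eqP E; move: lec; rewrite E cards0 muln0 leqn0.
  by move=> /eqP S0; move: ltS; rewrite S0.
rewrite !inE => /and3P [yS /eqP yj /eqP yi].
exists i, j, (a 0 i), b, y; split=> //; first by rewrite yi -eqc.
by rewrite yj -eqb eq_sym.
Qed.

(* The entries of the center [w] are taken from elements of [S]; hence [w]
   agrees with all of [S] wherever [S] is constant. *)
Lemma increasing_chain_exists (t d : nat) (S : {set 'rV[F]_t}) :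
  (#|F| ^ (2 * d) * (#|F| * t + 2) <= #|S|)%N ->
  exists w us, [/\ size us = d, increasing_chain us,
    forall u, u \in us -> u + w \in S
    & forall k, exists2 x, x \in S & x 0 k = w 0 k].
Proof.
have F0 : (0 < #|F|)%N by apply/card_gt0P; exists 0.
elim: d S => [|d IHd] S leS.
  have /set0Pn [w wS] : S != set0.
    by rewrite -card_gt0; apply: leq_trans leS; rewrite muln0 expn0 mul1n addn2.
  by exists w, [::]; split=> // k; exists w.
have [|i [j [a [b [v [ij vS via vjb leS']]]]]] := @popular_pair_step t S.
  apply: leq_trans leS; rewrite mulnS expnD; apply: leq_trans (leq_pmull _ _).
    by rewrite addn2 addn1.
  by rewrite muln_gt0 !expn_gt0 F0.
set S' := [set x in S | _] in leS'.
(* Fixing two coordinates costs a factor [#|F| ^ 2], which one unit of [d] pays for. *)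
have [|w [us [szus chus usS wS]]] := IHd S'.
  have := leq_trans leS leS'; rewrite mulnS expnD -mulnA leq_mul2l expn_eq0.
  by rewrite andbT eqn0Ngt F0.
have wi : w 0 i = a.
  by have [x] := wS i; rewrite !inE => /and3P [_ /eqP xi _] <-.
have wj : w 0 j = b.
  by have [x] := wS j; rewrite !inE => /and3P [_ _ /eqP xj] <-.
exists w, (v - w :: us); split => /=.
- by rewrite szus.
- rewrite chus andbT; apply/existsP; exists i; apply/existsP; exists j.
  rewrite ij !mxE wi wj !subr_eq0 via vjb /=; apply/allP=> u /usS.
  rewrite !inE !mxE wi wj => /and3P [_ ui uj].
  by rewrite -(inj_eq (addIr a)) add0r ui -(inj_eq (addIr b)) add0r uj.
- by move=> u; rewrite inE => /predU1P [->|/usS]; rewrite ?subrK // inE => /andP [].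
- by move=> k; have [x] := wS k; rewrite inE => /andP [xS _] xk; exists x.
Qed.

End Chains.

Lemma sum_rV_prod (F : finType) (K : comPzSemiRingType) (t : nat)
    (f : 'I_t -> F -> K) :
  \sum_(x : 'rV[F]_t) \prod_k f k (x ord0 k) = \prod_k \sum_a f k a.
Proof.
rewrite bigA_distr_bigA /=.
pose toffun (x : 'rV[F]_t) : {ffun 'I_t -> F} := [ffun k => x ord0 k].
have bij : bijective toffun.
  exists (fun g : {ffun 'I_t -> F} => \row_k g k) => [x|g].
    by apply/rowP=> k; rewrite mxE ffunE.
  by apply/ffunP=> k; rewrite ffunE mxE.
rewrite (reindex toffun) /=; last exact: onW_bij.
by apply: eq_bigr => x _; apply: eq_bigr => k _; rewrite ffunE.
Qed.

(** This reduces conditions on rows of length [n] to [n] separate moments, one for each column. *)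
Lemma sum_matrix_prod_col (F : finType) (K : comPzSemiRingType) (r n : nat)
    (f : 'I_n -> 'rV[F]_r -> K) :
  \sum_(Y : 'M[F]_(r, n)) \prod_k f k (\row_i Y i k) = \prod_k \sum_x f k x.
Proof.
rewrite bigA_distr_bigA /=.
pose toffun (Y : 'M[F]_(r, n)) : {ffun 'I_n -> 'rV[F]_r} := [ffun k => \row_i Y i k].
have bij : bijective toffun.
  exists (fun g : {ffun 'I_n -> 'rV[F]_r} => \matrix_(i, k) g k ord0 i) => [Y|g].
    by apply/matrixP=> i k; rewrite mxE ffunE mxE.
  by apply/ffunP=> k; rewrite ffunE; apply/rowP=> i; rewrite !mxE.
rewrite (reindex toffun) /=; last exact: onW_bij.
by apply: eq_bigr => Y _; apply: eq_bigr => k _; rewrite ffunE.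
Qed.

Section RowMoment.
Variables (F : finFieldType) (K : realFieldType) (t : nat).
Variables (p phi : F -> K) (kappa : K).
Hypothesis p_ge0 : forall a, 0 <= p a.
Hypothesis p_sum : \sum_a p a = 1.
Hypothesis phi_ge0 : forall a, 0 <= phi a.
Hypothesis two_coordinates : forall al be z : F, al != 0 -> be != 0 ->
  \sum_a p a * \sum_b p b * phi (al * a + be * b + z) <= kappa.

Let W (x : 'rV[F]_t) : K := \prod_k p (x 0 k).

(** Exchanging coordinate [i] with an independent symbol of law [p] is an involution that preserves
    the product weight. *)
Lemma resample_coordinate (G : 'rV[F]_t -> K) (i : 'I_t) :
  \sum_x W x * G x = \sum_x W x * \sum_a p a * G (row_update x i a).
Proof.
transitivity (\sum_(xa : 'rV[F]_t * F) W xa.1 * p xa.2 * G xa.1).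
  rewrite -(pair_bigA _ (fun x a => W x * p a * G x)) /=.
  apply: eq_bigr => x _; rewrite -big_distrl -big_distrr /= p_sum.
  by rewrite mulr1.
pose sw (xa : 'rV[F]_t * F) := (row_update xa.1 i xa.2, xa.1 0 i).
have swK : involutive sw.
  case=> x a; rewrite /sw /=; congr pair; last by rewrite mxE eqxx.
  by apply/rowP=> k; rewrite !mxE; case: eqP => [->|].
rewrite (reindex_inj (inv_inj swK)) /=.
rewrite -(pair_bigA _ (fun x a => W (row_update x i a) * p (x 0 i) *
  G (row_update x i a))) /=.
apply: eq_bigr => x _; rewrite big_distrr /=; apply: eq_bigr => a _.
rewrite mulrA; congr (_ * _); rewrite /W (bigD1 i) //= [RHS]mulrC [in RHS](bigD1 i) //=.
rewrite mxE eqxx mulrA -!mulrA; congr (_ * _); rewrite mulrC; congr (_ * _).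
by apply: eq_bigr => k /negPf ki; rewrite mxE ki.
Qed.

(** Resample the two fresh coordinates of the head: the factors of the tail do not change, and the
    factor of the head averages to at most [kappa], whatever the other coordinates are. *)
Lemma row_moment_chain (us : seq 'rV[F]_t) (y : F) : increasing_chain us ->
  \sum_x W x * \prod_(u <- us) phi (\sum_k u 0 k * x 0 k - y)
    <= kappa ^+ size us.
Proof.
have W_ge0 x : 0 <= W x by apply: prodr_ge0.
elim: us => [_|u us IHus] /=.
  under eq_bigr => x _ do rewrite big_nil mulr1.
  rewrite /W (sum_rV_prod (fun _ => p)).
  by rewrite big1.
case/andP=> /existsP [i /existsP [j /and4P [ij ui uj /allP us0]]] chus.
have kappa_ge0 : 0 <= kappa.
  apply: le_trans (two_coordinates 0 ui uj); apply: sumr_ge0 => a _.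
  by rewrite mulr_ge0 // sumr_ge0 // => b _; rewrite mulr_ge0.
pose Q (x : 'rV[F]_t) := \prod_(u <- us) phi (\sum_k u 0 k * x 0 k - y).
have Q_ge0 x : 0 <= Q x by apply: prodr_ge0.
have Qupd x a b : Q (row_update (row_update x i a) j b) = Q x.
  rewrite /Q !big_seq; apply: eq_bigr => v /us0 /andP [/eqP vi /eqP vj].
  congr (phi (_ - _)); apply: eq_bigr => k _; rewrite !mxE.
  by case: eqP => [->|_]; rewrite ?vj ?mul0r //; case: eqP => [->|_]; rewrite ?vi ?mul0r.
rewrite (resample_coordinate _ j) exprS; rewrite (resample_coordinate _ i).
have le1 x : W x * (\sum_a p a * \sum_b p b *
    \prod_(u0 <- u :: us) phi (\sum_k u0 0 k *
       row_update (row_update x i a) j b 0 k - y)) <= kappa * (W x * Q x).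
  rewrite mulrCA ler_wpM2l //.
  under eq_bigr => a _.
    under eq_bigr => b _.
      rewrite big_cons -/(Q _) Qupd mulrA; over.
    rewrite -big_distrl /= mulrA; over.
  rewrite -big_distrl /= ler_wpM2r //.
  pose z := \sum_(k | (k != i) && (k != j)) u 0 k * x 0 k - y.
  apply: le_trans (two_coordinates z ui uj).
  rewrite le_eqVlt; apply/orP; left; apply/eqP.
  apply: eq_bigr => a _; congr (_ * _); apply: eq_bigr => b _; congr (_ * phi _).
  rewrite (bigD1 i) //= (bigD1 j) 1?eq_sym //= !mxE !eqxx (negPf ij) /z !addrA.
  congr (_ - _); congr (_ + _); apply: eq_bigr => k /andP [/negPf ki /negPf kj].
  by rewrite !mxE ki kj.
apply: (@le_trans _ _ (\sum_x kappa * (W x * Q x))).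
  by apply: ler_sum => x _; apply: le1.
rewrite -big_distrr /= ler_wpM2l //; exact: IHus.
Qed.

End RowMoment.

(** * Matrices annihilating many points of a set *)

Lemma card_le_sum_cover (T I : finType) (A : {set T}) (D : I -> {set T}) :
  (forall x, x \in A -> exists i, x \in D i) -> (#|A| <= \sum_i #|D i|)%N.
Proof.
move=> cov; rewrite -sum1_card.
under [leqRHS]eq_bigr => i _ do rewrite -sum1_card big_mkcond.
rewrite exchange_big /= [leqLHS]big_mkcond; apply: leq_sum => x _.
by case: ifP => // /cov [i xi]; rewrite (bigD1 i) //= xi.
Qed.

Lemma card_le_sum_cover_in (T I : finType) (P : {pred I}) (A : {set T})
    (D : I -> {set T}) :
  (forall x, x \in A -> exists2 i, i \in P & x \in D i) ->
  (#|A| <= \sum_(i in P) #|D i|)%N.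
Proof.
move=> cov; rewrite big_mkcond /=.
have := @card_le_sum_cover T I A (fun i => if i \in P then D i else set0).
under eq_bigr => i _ do rewrite (fun_if (fun X : {set T} => #|X|)) cards0.
by apply=> x /cov [i iP xi]; exists i; rewrite iP.
Qed.

Section Kernels.
Variable F : finFieldType.

(** [pinvmx Y^T] is a left inverse of [Y^T], so an annihilator [H] gives
    [(H + Z *m pinvmx Y^T) *m Y^T = Z]: the translates for different [Z] are disjoint, and there are
    [#|F| ^ (M * r)] of them. *)
Lemma card_annihilators (M n r : nat) (Y : 'M[F]_(r, n)) : \rank Y = r ->
  (#|[set H : 'M[F]_(M, n) | (H *m Y^T == 0)%R]| * #|F| ^ (M * r) <= #|F| ^ (M * n))%N.
Proof.
move=> rkY; rewrite -!card_mx -cardsT -cardsX -[leqRHS]cardsT.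
have fullY : row_full Y^T by rewrite /row_full mxrank_tr rkY.
set A := setX _ _.
pose f (HZ : 'M[F]_(M, n) * 'M[F]_(M, r)) := HZ.1 + HZ.2 *m pinvmx Y^T.
have injf : {in A &, injective f}.
  have fK H Z : H *m Y^T == 0 -> f (H, Z) *m Y^T = Z.
    by move=> /eqP H0; rewrite mulmxDl H0 add0r -mulmxA mulVpmx // mulmx1.
  case=> H Z [H' Z']; rewrite !inE !andbT => H0 H0' eqf.
  have eqZ : Z = Z' by rewrite -(fK H Z H0) eqf fK.
  by move: eqf; rewrite /f eqZ /= => /addIr ->.
by rewrite -(card_in_imset injf); apply/subset_leq_card/subsetP.
Qed.

(** Each fiber of the map from [H] to [H *m v] is empty or a translate of the fiber over [0]. *)
Lemma card_kernel_ge (s n : nat) (v : 'cV[F]_n) :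
  (#|F| ^ (s * n) <= #|F| ^ s * #|[set H : 'M[F]_(s, n) | (H *m v == 0)%R]|)%N.
Proof.
rewrite -card_mx -cardsT.
apply: (@leq_trans (\sum_(y : 'cV[F]_s) #|[set H : 'M[F]_(s, n) | (H *m v == 0)%R]|)%N).
  apply: leq_trans (@card_le_sum_cover _ _ _ (fun y => [set H : 'M[F]_(s, n) | H *m v == y]) _) _.
    by move=> H _; exists (H *m v); rewrite inE.
  apply: leq_sum => y _.
  have [->|/set0Pn [H0]] := eqVneq [set H : 'M[F]_(s, n) | H *m v == y] set0.
    by rewrite cards0.
  rewrite inE => /eqP H0y.
  rewrite -(card_imset _ (addIr (- H0))); apply/subset_leq_card/subsetP => H'.
  case/imsetP=> H; rewrite inE => /eqP Hy ->.
  by rewrite inE mulmxBl Hy H0y subrr.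
by rewrite sum_nat_const card_mx muln1.
Qed.

(** Greedy choice: members of [A] outside the current span are appended until there are [t0] of them
    or [A] is spanned. *)
Lemma independent_or_spanning_rows (n t0 : nat) (A : {set 'rV[F]_n}) :
  (exists Y : 'M[F]_(t0, n), \rank Y = t0 /\ forall i, row i Y \in A) \/
  (exists r (Y : 'M[F]_(r, n)), [/\ (r < t0)%N, \rank Y = r,
     forall i, row i Y \in A & forall a, a \in A -> (a <= Y)%MS]).
Proof.
elim: t0 => [|t0 [[Y [rkY YA]]|[r [Y [lt_r rkY YA AY]]]]].
- by left; exists 0; split=> [|[]//]; rewrite mxrank0.
- have [spanA|] := boolP [forall a in A, (a <= Y)%MS].
    right; exists t0, Y; split=> // a aA; exact: (forall_inP spanA).
  rewrite negb_forall_in => /exists_inP [a aA naY]; left.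
  exists (castmx (addn1 t0, erefl n) (col_mx Y a)).
  split=> [|i].
    have : (\rank (col_mx Y a) <= t0 + 1)%N by apply: rank_leq_row.
    have : (\rank Y < \rank (col_mx Y a))%N.
      apply: rank_ltmx; rewrite ltmxE col_mx_sub negb_and naY orbT andbT.
      by rewrite -addsmxE addsmxSl.
    rewrite rkY => lt_rk le_rk.
    have -> : \rank (castmx (addn1 t0, erefl n) (col_mx Y a)) = \rank (col_mx Y a).
      by case: _ / (addn1 t0); rewrite castmx_id.
    by apply/eqP; rewrite eqn_leq lt_rk andbT; apply: leq_trans le_rk _; rewrite addn1.
  rewrite -[i](cast_ordKV (addn1 t0)); set i' := cast_ord _ i.
  have -> : row (cast_ord (addn1 t0) i') (castmx (addn1 t0, erefl n) (col_mx Y a))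
      = row i' (col_mx Y a).
    by apply/rowP=> k; rewrite !mxE castmxE /= cast_ordK cast_ord_id mxE.
  case: (splitP i') => k eqk.
    have -> : i' = lshift 1 k by apply: val_inj.
    by rewrite rowKu.
  have -> : i' = rshift t0 k by apply: val_inj.
  by rewrite rowKd (ord1 k) row_id.
- by right; exists r, Y; split=> //; apply: ltnW.
Qed.

End Kernels.

Section BadMatrices.
Variables (F : finFieldType) (K : realFieldType) (n M d t0 N : nat).
Variables (B : {set 'rV[F]_n}) (p phi : 'I_n -> F -> K) (beta zeta kappa : K).
Hypothesis p_ge0 : forall k a, 0 <= p k a.
Hypothesis p_sum : forall k, \sum_a p k a = 1.
Hypothesis phi_ge0 : forall k a, 0 <= phi k a.
Hypothesis two_coordinates : forall k (al be z : F), al != 0 -> be != 0 ->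
  \sum_a p k a * \sum_b p k b * phi k (al * a + be * b + z) <= kappa.
Hypothesis kappa_ge0 : 0 <= kappa.
Hypothesis beta_gt0 : 0 < beta.
Hypothesis zeta_gt0 : 0 < zeta.
Hypothesis beta_le : forall x : 'rV[F]_n, x \in B -> beta <= \prod_k p k (x 0 k).
Hypothesis zeta_le : forall x : 'rV[F]_n, x \in B -> zeta <= \prod_k phi k (x 0 k).

Let q : K := #|F|%:R.

Let q_gt0 : 0 < q.
Proof. by rewrite ltr0n; apply/card_gt0P; exists 0. Qed.

(** Markov's inequality. Weigh the rows of [Y] by [p] and the shifted combinations by [phi]: each
    counted matrix weighs at least [beta ^+ r * zeta ^+ size us], while the total weight factors
    over the columns, each contributing at most [kappa ^+ size us]. *)
Lemma card_rows_in_ball_chain (r : nat) (us : seq 'rV[F]_r) (y : 'rV[F]_n) :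
  increasing_chain us ->
  #|[set Y : 'M[F]_(r, n) | [forall i, row i Y \in B] &&
      all (fun u => u *m Y - y \in B) us]|%:R * beta ^+ r * zeta ^+ size us
    <= (kappa ^+ n) ^+ size us.
Proof.
move=> chus.
pose f (k : 'I_n) (x : 'rV[F]_r) : K := (\prod_i p k (x 0 i)) *
  \prod_(u <- us) phi k (\sum_i u 0 i * x 0 i - y 0 k).
have f_ge0 k x : 0 <= f k x by rewrite mulr_ge0 // prodr_ge0.
apply: (@le_trans _ _ (\sum_(Y : 'M[F]_(r, n)) \prod_k f k (\row_i Y i k))).
  rewrite -sum1_card natr_sum -mulrA big_distrl /= big_mkcond /=.
  apply: ler_sum => Y _; case: ifP => [|_]; last by apply: prodr_ge0.
  rewrite inE mul1r => /andP [/forallP YB /allP usB].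
  rewrite /f big_split /=; apply: ler_pM; rewrite ?exprn_ge0 ?(ltW beta_gt0) ?(ltW zeta_gt0) //.
    have -> : beta ^+ r = \prod_(i < r) beta by rewrite prodr_const card_ord.
    rewrite exchange_big /=.
    apply: ler_prod => i _; rewrite (ltW beta_gt0) /=.
    apply: le_trans (beta_le (YB i)) _; rewrite le_eqVlt; apply/orP; left.
    by apply/eqP/eq_bigr => k _; rewrite !mxE.
  have -> (vs : seq 'rV[F]_r) : zeta ^+ size vs = \prod_(v <- vs) zeta.
    by elim: vs => [|v vs IHvs]; rewrite ?big_nil // big_cons exprS IHvs.
  rewrite exchange_big /= big_seq [leRHS]big_seq.
  apply: ler_prod => u /usB uB; rewrite (ltW zeta_gt0) /=.
  apply: le_trans (zeta_le uB) _; rewrite le_eqVlt; apply/orP; left.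
  apply/eqP/eq_bigr => k _; congr (phi k _); rewrite !mxE; congr (_ - _).
  by apply: eq_bigr => i _; rewrite mxE.
rewrite sum_matrix_prod_col -exprM mulnC exprM.
have -> : (kappa ^+ size us) ^+ n = \prod_(k < n) kappa ^+ size us.
  by rewrite prodr_const card_ord.
apply: ler_prod => k _; rewrite sumr_ge0 //=.
by apply: row_moment_chain => // al be z; apply: two_coordinates.
Qed.

(** Union bound: [q ^+ (r * d)] counts the tuples and [q ^+ n] the shifts [y]. *)
Lemma card_rows_in_ball_some_chain (r : nat) :
  #|[set Y : 'M[F]_(r, n) | [exists us : d.-tuple 'rV[F]_r, exists y : 'rV[F]_n,
      [&& increasing_chain us, [forall i, row i Y \in B] &
      all (fun u => u *m Y - y \in B) us]]]|%:R * beta ^+ r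
    <= q ^+ (r * d) * q ^+ n * (kappa ^+ n / zeta) ^+ d.
Proof.
set A := [set Y | _].
pose D (uy : d.-tuple 'rV[F]_r * 'rV[F]_n) := [set Y : 'M[F]_(r, n) |
  [&& increasing_chain uy.1, [forall i, row i Y \in B] &
      all (fun u => u *m Y - uy.2 \in B) uy.1]].
have leA : (#|A| <= \sum_uy #|D uy|)%N.
  apply: card_le_sum_cover => Y; rewrite inE => /existsP [us /existsP [y h]].
  by exists (us, y); rewrite inE.
have leD uy : #|D uy|%:R * beta ^+ r <= (kappa ^+ n / zeta) ^+ d.
  rewrite expr_div_n ler_pdivlMr ?exprn_gt0 //.
  case: uy => us y; rewrite /D /=; have [ch|nch] := boolP (increasing_chain us).
    by have := card_rows_in_ball_chain y ch; rewrite size_tuple.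
  have -> : [set Y : 'M[F]_(r, n) | false && ([forall i, row i Y \in B] &&
      all (fun u => u *m Y - y \in B) us)] = set0 by apply/setP=> Y; rewrite !inE.
  by rewrite cards0 !mul0r; apply: exprn_ge0; apply: exprn_ge0.
apply: (@le_trans _ _ (\sum_uy #|D uy|%:R * beta ^+ r)).
  rewrite -big_distrl /= ler_wpM2r ?exprn_ge0 ?(ltW beta_gt0) //.
  by rewrite -natr_sum ler_nat.
apply: (@le_trans _ _ (\sum_(uy : d.-tuple 'rV[F]_r * 'rV[F]_n)
    (kappa ^+ n / zeta) ^+ d)).
  by apply: ler_sum => uy _.
rewrite sumr_const card_prod card_tuple !card_mx !mul1n -expnM.
by rewrite -mulr_natl natrM !natrX.
Qed.

(** Union bound over [E]: a fixed [Y] of rank [r] is annihilated by at most a fraction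
    [q ^- (M * r)] of all matrices. *)
Lemma card_killers (r : nat) (E : {set 'M[F]_(r, n)}) (c : K) :
  (forall Y, Y \in E -> \rank Y = r) -> #|E|%:R * beta ^+ r <= c ->
  #|[set H : 'M[F]_(M, n) | [exists Y in E, H *m Y^T == 0]]|%:R
    <= q ^+ (M * n) * (c / (q ^+ M * beta) ^+ r).
Proof.
move=> rkE leE.
have leS : (#|[set H : 'M[F]_(M, n) | [exists Y in E, (H *m Y^T == 0)%R]]| <=
   \sum_(Y in E) #|[set H : 'M[F]_(M, n) | (H *m Y^T == 0)%R]|)%N.
  apply: card_le_sum_cover_in => H; rewrite inE => /exists_inP [Y YE HY].
  by exists Y; rewrite ?inE.
apply: (@le_trans _ _ (\sum_(Y in E) q ^+ (M * n) / q ^+ (M * r))).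
  apply: le_trans (_ : _ <= (\sum_(Y in E)
    #|[set H : 'M[F]_(M, n) | (H *m Y^T == 0)%R]|)%:R) _; first by rewrite ler_nat.
  rewrite natr_sum; apply: ler_sum => Y YE; rewrite ler_pdivlMr ?exprn_gt0 //.
  by rewrite -!natrX -natrM ler_nat; apply: card_annihilators; apply: rkE.
rewrite sumr_const -mulr_natl exprMn -exprM mulrCA ler_wpM2l ?exprn_ge0 ?(ltW q_gt0) //.
rewrite ler_pdivlMr ?mulr_gt0 ?exprn_gt0 //.
by rewrite exprM mulrA divfK // !expf_neq0 // gt_eqF.
Qed.

(** Among more than [N] kernel points in [B], either [t0] are independent, which gives the first
    term, or fewer than [t0] span them all. Their coefficient vectors then contain a shifted chain,
    which gives the second term, summed over the possible ranks. *)
Lemma card_bad_matrices :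
  1 <= q ^+ M * beta -> (#|F| ^ (2 * d) * (#|F| * t0 + 2) <= N)%N ->
  #|[set H : 'M[F]_(M, n) | (N < #|[set x in B | (H *m x^T == 0)%R]|)%N]|%:R
    <= q ^+ (M * n) * ((q ^+ M * beta) ^- t0 +
         t0%:R * (q ^+ (t0 * d) * q ^+ n * (kappa ^+ n / zeta) ^+ d)).
Proof.
move=> ge1 leN.
pose E1 := [set Y : 'M[F]_(t0, n) | (\rank Y == t0) && [forall i, row i Y \in B]].
pose E2 r := [set Y : 'M[F]_(r, n) | (\rank Y == r) &&
   [exists us : d.-tuple 'rV[F]_r, exists y : 'rV[F]_n,
      [&& increasing_chain us, [forall i, row i Y \in B] &
      all (fun u => u *m Y - y \in B) us]]].
pose D (o : option 'I_t0) : {set 'M[F]_(M, n)} :=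
  if o is Some r then [set H | [exists Y in E2 r, H *m Y^T == 0]]
  else [set H | [exists Y in E1, H *m Y^T == 0]].
have cover : (#|[set H : 'M[F]_(M, n) |
    (N < #|[set x in B | (H *m x^T == 0)%R]|)%N]| <= \sum_o #|D o|)%N.
  apply: card_le_sum_cover => H; rewrite inE => ltN.
  have killed r (Y : 'M[F]_(r, n)) :
      (forall i, row i Y \in [set x in B | H *m x^T == 0]) -> H *m Y^T == 0.
    move=> YA; apply/eqP/matrixP=> a i; have := YA i; rewrite inE => /andP [_ /eqP].
    move/matrixP/(_ a 0); rewrite !mxE => h; rewrite -[RHS]h.
    by apply: eq_bigr => k _; rewrite !mxE.
  case: (independent_or_spanning_rows t0 [set x in B | H *m x^T == 0]).
    case=> Y [rkY YA]; exists None; rewrite inE; apply/exists_inP; exists Y.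
      rewrite inE rkY eqxx; apply/forallP=> i.
      by have := YA i; rewrite inE => /andP [].
    exact: killed.
  case=> r [Y [lt_r rkY YA AY]]; exists (Some (Ordinal lt_r)) => /=.
  rewrite inE; apply/exists_inP; exists Y; last exact: killed.
  rewrite inE rkY eqxx /=.
  (* Every kernel point in [B] is [c *m Y] for some [c] in [S], so [S] has more than [N] members. *)
  pose S := [set c : 'rV[F]_r | c *m Y \in B].
  have leS : (#|F| ^ (2 * d) * (#|F| * r + 2) <= #|S|)%N.
    apply: (@leq_trans N).
      apply: leq_trans leN; rewrite leq_mul2l leq_add2r leq_mul2l (ltnW lt_r).
      by rewrite !orbT.
    apply: ltnW; apply: leq_trans ltN _.
    apply: leq_trans (leq_imset_card (fun c => c *m Y) S); apply/subset_leq_card.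
    apply/subsetP=> x xA; have /submxP [c xc] := AY x xA.
    apply/imsetP; exists c => //; rewrite inE -xc.
    by move: xA; rewrite inE => /andP [].
  have [w [us [szus chus usS _]]] := increasing_chain_exists leS.
  apply/existsP; exists (@Tuple d _ us (introT eqP szus)).
  apply/existsP; exists (- (w *m Y)); rewrite chus /=; apply/andP; split.
    by apply/forallP=> i; have := YA i; rewrite inE => /andP [].
  by apply/allP=> u /usS; rewrite inE opprK mulmxDl.
apply: (@le_trans _ _ (\sum_o #|D o|%:R)); first by rewrite -natr_sum ler_nat.
rewrite (bigD1 None) //= mulrDr; apply: lerD.
  have := @card_killers t0 E1 1; rewrite div1r; apply.
    by move=> Y; rewrite inE => /andP [/eqP].
  (* With the empty chain, the bound says that at most [beta ^- t0] matrices have all their rows in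
     [B]. *)
  have := @card_rows_in_ball_chain t0 [::] 0 isT; rewrite !expr0 mulr1.
  apply: le_trans; rewrite ler_wpM2r ?exprn_ge0 ?(ltW beta_gt0) // ler_nat.
  by apply/subset_leq_card/subsetP=> Y; rewrite !inE => /andP [_ ->].
rewrite mulrCA; set c := _ * (_ * _ * _).
apply: (@le_trans _ _ (\sum_(o : option 'I_t0 | o != None) c)); last first.
  rewrite (@sumr_const _ (option 'I_t0) (predC1 None)) cardC1 card_option card_ord.
  by rewrite mulr_natl.
have q_ge1 : 1 <= q by rewrite ler1n; apply/card_gt0P; exists 0.
have kz_ge0 : 0 <= kappa ^+ n / zeta by rewrite divr_ge0 ?exprn_ge0 ?(ltW zeta_gt0).
apply: ler_sum => -[r _|//]; rewrite /D.
apply: le_trans (card_killers _ (_ : _ <= q ^+ (r * d) * q ^+ n *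
    (kappa ^+ n / zeta) ^+ d)) _.
- by move=> Y; rewrite inE => /andP [/eqP].
- apply: le_trans (card_rows_in_ball_some_chain r).
  rewrite ler_wpM2r ?exprn_ge0 ?(ltW beta_gt0) // ler_nat.
  by apply/subset_leq_card/subsetP=> Y; rewrite !inE => /andP [_ ->].
(* By [ge1] the divisor [(q ^+ M * beta) ^+ r] is at least [1]; the exponent [r * d] is raised to
   [t0 * d]. *)
rewrite /c ler_wpM2l ?exprn_ge0 ?(ltW q_gt0) //.
rewrite ler_pdivrMr ?exprn_gt0 ?(lt_le_trans ltr01) //.
rewrite -[leLHS]mulr1; apply: ler_pM => //.
- by rewrite !mulr_ge0 ?exprn_ge0 ?(ltW q_gt0).
- rewrite !ler_wpM2r ?exprn_ge0 ?(ltW q_gt0) // ler_weXn2l // leq_mul2r.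
  by rewrite ltnW ?orbT.
- by rewrite exprn_ege1.
Qed.

End BadMatrices.

(** * Fresh symbols, and extension by random parity checks *)

Lemma sum_affine (F : finFieldType) (V : nmodType) (f : F -> V) (al z : F) :
  al != 0 -> \sum_a f (al * a + z) = \sum_a f a.
Proof.
move=> al0; rewrite [RHS](reindex (fun a => al * a + z)) //=.
apply: onW_bij; exists (fun x => (x - z) / al) => a.
  by rewrite addrK mulrAC mulfV // mul1r.
by rewrite mulrCA mulfV // mulr1 subrK.
Qed.

Section TwoCoordinates.
Variables (F : finFieldType) (K : realFieldType) (T : {set F}) (p0 p1 g : K).
Hypotheses (p0_ge0 : 0 <= p0) (le_p01 : p0 <= p1) (g_ge0 : 0 <= g).
Hypothesis total : #|T|%:R * p1 + (#|F|%:R - #|T|%:R) * p0 = 1.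

Let p a := if a \in T then p1 else p0.
Let ind a : K := (a \in T)%:R.

Let sum_ind : \sum_a ind a = #|T|%:R.
Proof. by rewrite -natr_sum -sum1_card [in RHS]big_mkcond. Qed.

Let pE a : p a = p0 + (p1 - p0) * ind a.
Proof. by rewrite /p /ind; case: (a \in T); rewrite ?mulr1 ?mulr0 ?addr0 // subrKC. Qed.

Lemma sum_two_valued : \sum_a p a = 1.
Proof.
under eq_bigr => a _ do rewrite pE.
rewrite big_split /= -big_distrr /= sum_ind -[RHS]total.
have -> : \sum_(a : F) p0 = #|F|%:R * p0 by rewrite sumr_const mulr_natl.
by rewrite !mulrBl addrCA [p1 * _]mulrC; congr (_ + (_ - _)); rewrite mulrC.
Qed.

(** Split [p b] into the constant [p0] and an excess [p1 - p0] on [T]. Under the constant part,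
    exactly [#|T|] values of [b] bring the sum into [T]. For each [b] in [T], exactly [#|T|] values
    of [a] do, each of mass at most [p1]. *)
Lemma two_coordinates_moment (al be z : F) : al != 0 -> be != 0 ->
  \sum_a p a * \sum_b p b * (if al * a + be * b + z \in T then 1 + g else 1)
    <= 1 + g * (#|T|%:R * (p0 + (p1 - p0) * (#|T|%:R * p1))).
Proof.
move=> al0 be0; have dp_ge0 : 0 <= p1 - p0 by rewrite subr_ge0.
have ind_ge0 a : 0 <= ind a by rewrite ler0n.
have p_ge0 a : 0 <= p a by rewrite pE addr_ge0 ?mulr_ge0.
have phiE x : (if x \in T then 1 + g else 1) = 1 + g * ind x.
  by rewrite /ind; case: (x \in T); rewrite ?mulr1 ?mulr0 ?addr0.
have -> : \sum_a p a * \sum_b p b * (if al * a + be * b + z \in T then 1 + g else 1)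
   = 1 + g * \sum_a p a * \sum_b p b * ind (al * a + be * b + z).
  under eq_bigr => a _.
    under eq_bigr => b _ do rewrite phiE mulrDr mulr1 mulrCA.
    rewrite big_split /= sum_two_valued -big_distrr /= mulrDr mulr1 mulrCA; over.
  by rewrite big_split /= sum_two_valued -big_distrr.
rewrite lerD2l ler_wpM2l //.
have -> : \sum_a p a * \sum_b p b * ind (al * a + be * b + z)
   = p0 * #|T|%:R + (p1 - p0) * \sum_b ind b * \sum_a p a * ind (al * a + be * b + z).
  transitivity (\sum_a (p a * (p0 * #|T|%:R) +
     (p1 - p0) * \sum_b ind b * (p a * ind (al * a + be * b + z)))).
    apply: eq_bigr => a _.
    under eq_bigr => b _ do rewrite pE mulrDl -mulrA.
    rewrite big_split /= mulrDr -!big_distrr /=; congr (_ + _).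
      rewrite -sum_ind -(sum_affine ind (al * a + z) be0).
      by congr (_ * (_ * _)); apply: eq_bigr => b _; rewrite addrCA addrA.
    rewrite mulrCA; congr (_ * _); rewrite big_distrr /=.
    by apply: eq_bigr => b _; rewrite mulrCA.
  rewrite big_split /= -big_distrl /= sum_two_valued mul1r; congr (_ + _).
  rewrite -big_distrr /= exchange_big /=; congr (_ * _).
  by apply: eq_bigr => b _; rewrite big_distrr.
rewrite mulrDr [p0 * _]mulrC lerD2l mulrCA ler_wpM2l // -sum_ind big_distrl /=.
apply: ler_sum => b _; rewrite ler_wpM2l //.
rewrite -(sum_affine ind (be * b + z) al0) big_distrl /=.
apply: ler_sum => a _; rewrite addrA [leRHS]mulrC ler_wpM2r //.
by rewrite /p; case: ifP.
Qed.

End TwoCoordinates.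

Section RowExtension.
Variables (F : finFieldType) (n : nat) (Bs : {set {set 'cV[F]_n}}).

Definition bad_matrices (m N : nat) : {set 'M[F]_(m, n)} :=
  [set H | [exists X in Bs, (N < #|[set x in X | (H *m x == 0)%R]|)%N]].

(* A list of size [L] keeps on average [L / q ^ s] members when [s] random parity
   checks are added; since at most [L] survive, at least half of this average
   survives with probability at least [1 / (2 q ^ s)]. *)
Lemma many_extensions (s N : nat) (A : {set 'cV[F]_n}) :
  (2 * #|F| ^ s * N < #|A|)%N ->
  (#|F| ^ (s * n) <= 2 * #|F| ^ s *
     #|[set H : 'M[F]_(s, n) | (N < #|[set x in A | (H *m x == 0)%R]|)%N]|)%N.
Proof.
move=> ltA; set good := [set H | _].
have A_gt0 : (0 < #|A|)%N by apply: leq_trans ltA.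
pose c (H : 'M[F]_(s, n)) := #|[set x in A | H *m x == 0]|.
have le1 : (#|A| * #|F| ^ (s * n) <= #|F| ^ s * \sum_H c H)%N.
  have -> : (\sum_H c H = \sum_(x in A) #|[set H : 'M[F]_(s, n) | (H *m x == 0)%R]|)%N.
    under eq_bigr => H _ do rewrite /c -sum1dep_card big_mkcondr.
    rewrite exchange_big /=; apply: eq_bigr => x _.
    by rewrite -sum1dep_card [RHS]big_mkcond.
  rewrite big_distrr /= -sum_nat_const; apply: leq_sum => x _.
  exact: card_kernel_ge.
have le2 : (\sum_H c H <= #|A| * #|good| + #|F| ^ (s * n) * N)%N.
  rewrite (bigID (mem good)) /=; apply: leq_add.
    rewrite mulnC -sum_nat_const.
    by apply: leq_sum => H _; apply/subset_leq_card/subsetP=> x; rewrite inE => /andP [].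
  rewrite -card_mx -cardsT -sum_nat_const.
  rewrite big_mkcond [leqRHS]big_mkcond /=; apply: leq_sum => H _.
  by rewrite !inE; case: ltnP.
(* By [ltA], the term [#|F| ^ (s * n) * N] of [le2] accounts for at most half of the total in
   [le1]. *)
rewrite -(leq_pmul2l A_gt0).
nia.
Qed.

(** Double counting of stacked matrices: at least one in [2 * #|F| ^ s] extensions of a bad matrix
    is bad, and stacking is injective. *)
Lemma card_bad_matrices_extend (m s N : nat) :
  (#|bad_matrices m (2 * #|F| ^ s * N)| * #|F| ^ (s * n) <=
   2 * #|F| ^ s * #|bad_matrices (m + s) N|)%N.
Proof.
set bad := bad_matrices m _.
pose ext (H : 'M[F]_(m, n)) : {set 'M[F]_(s, n)} :=
  [set H' | col_mx H H' \in bad_matrices (m + s) N].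
have le_ext H : H \in bad -> (#|F| ^ (s * n) <= 2 * #|F| ^ s * #|ext H|)%N.
  rewrite inE => /exists_inP [X XB /many_extensions leH]; apply: leq_trans leH _.
  rewrite leq_mul2l; apply/orP; right; apply/subset_leq_card/subsetP=> H'.
  rewrite !inE => ltN; apply/exists_inP; exists X => //.
  move: ltN; congr (_ < _)%N; apply: eq_card => x.
  by rewrite !inE mul_col_mx col_mx_eq0 andbA.
apply: (@leq_trans (\sum_(H in bad) 2 * #|F| ^ s * #|ext H|)%N).
  by rewrite -sum_nat_const; apply: leq_sum => H /le_ext.
rewrite -big_distrr /= leq_mul2l; apply/orP; right.
under eq_bigr => H _ do rewrite -sum1_card.
rewrite pair_big_dep /= sum1dep_card.
have inj : injective (fun HH : 'M[F]_(m, n) * 'M[F]_(s, n) => col_mx HH.1 HH.2).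
  by case=> H1 H2 [H1' H2'] /= /eq_col_mx [-> ->].
rewrite -(card_imset _ inj); apply/subset_leq_card/subsetP=> Z.
by case/imsetP=> -[H H']; rewrite !inE /= => /andP [_ h] ->.
Qed.

End RowExtension.

(** * Families of sets of a fixed size *)

Lemma bin_leq_expn (q l : nat) : ('C(q, l) <= q ^ l)%N.
Proof.
apply: leq_trans (leq_pmulr _ (fact_gt0 l)) _; rewrite bin_ffact ffact_prod.
have -> : (q ^ l = \prod_(i < l) q)%N by rewrite prod_nat_const card_ord.
by apply: leq_prod => i _; apply: leq_subr.
Qed.

Lemma card_fixed_size_families (F : finType) (n l : nat) :
  (#|[set T : {ffun 'I_n -> {set F}} | [forall i, #|T i| == l]]| <= #|F| ^ (l * n))%N.
Proof.
have -> : #|[set T : {ffun 'I_n -> {set F}} | [forall i, #|T i| == l]]|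
    = #|@ffun_on_mem 'I_n _ (mem [set A : {set F} | #|A| == l])|.
  rewrite cardsE; apply: eq_card => T; rewrite !inE.
  by apply/forallP/forallP => h i; have := h i; rewrite inE.
rewrite card_ffun_on card_ord card_draws expnM.
by case: n => // n'; rewrite leq_exp2r // bin_leq_expn.
Qed.

(** This lets the union bound range over sets of exactly [l] elements, since enlarging the sets only
    enlarges the ball. *)
Lemma superset_of_size (F : finType) (A : {set F}) (l : nat) :
  (#|A| <= l <= #|F|)%N -> exists2 A' : {set F}, A \subset A' & #|A'| = l.
Proof.
elim: l => [|l IHl] /andP [leA lelF].
  by exists A => //; apply/eqP; rewrite -leqn0.
move: leA; rewrite leq_eqVlt => /orP [/eqP eqA|ltA]; first by exists A.
have [|A' sAA' cA'] := IHl; first by rewrite -ltnS ltA ltnW.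
have /subsetPn [x _ xA'] : ~~ ([set: F] \subset A').
  by apply: contraL lelF => /subset_leq_card; rewrite cardsT cA' -ltnNge.
exists (x |: A'); first by apply: subset_trans sAA' (subsetU1 _ _).
by rewrite cardsU1 xA' cA'.
Qed.

Local Open Scope R_scope.

(** * Bounds for one family of lists *)

Lemma exp_le (x y : R) : x <= y -> exp x <= exp y.
Proof. by case=> [/exp_increasing /Rlt_le|->]; last exact: Rle_refl. Qed.

Lemma pow_exp (x : R) (n : nat) : 0 < x -> x ^ n = exp (INR n * ln x).
Proof. by move=> x0; rewrite -Rpower_pow. Qed.

Lemma Defs_RlebP (x y : R) : reflect (x <= y) (Defs.Rleb x y).
Proof. by rewrite /Defs.Rleb; case: Rle_dec => h; constructor. Qed.

(** As [c0 <= c1], the product decreases with the number of misses, which is at most [rho * n]. It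
    serves both for the masses [p1], [p0] and for the weights [1 + g], [1]. *)
Lemma lr_ball_prod_lower (F : finFieldType) (n : nat) (T : 'I_n -> {set F})
    (rho c0 c1 : R) (x : 'cV[F]_n) :
  0 < c0 <= c1 -> x \in lr_ball rho T ->
  exp (INR n * ((1 - rho) * ln c1 + rho * ln c0)) <=
  (\prod_k (if x k ord0 \in T k then c1 else c0))%R.
Proof.
move=> [c0_gt0 le_c]; rewrite /lr_ball inE  => /Defs_RlebP lew.
rewrite (bigID (fun k => x k ord0 \in T k)) /=.
rewrite (eq_bigr (fun=> c1)); last by move=> k ->.
rewrite [X in (_ * X)%R](eq_bigr (fun=> c0)); last by move=> k /negPf ->.
rewrite !prodr_const -!RpowE.
set a := #|_|; set w := #|_|.
have aw : INR a + INR w = INR n.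
  rewrite -plus_INR -[n in RHS]card_ord -(cardC (fun k => x k ord0 \in T k)).
  by congr INR.
have {}lew : INR w <= rho * INR n.
  by move: lew; rewrite cardsE.
have c1_gt0 : 0 < c1 by lra.
rewrite (pow_exp _ c0_gt0) (pow_exp _ c1_gt0) -RmultE -exp_plus.
apply: exp_le.
have lec : ln c0 <= ln c1.
  by case: le_c => [/(ln_increasing _ _ c0_gt0) /Rlt_le|->]; last exact: Rle_refl.
rewrite -aw in lew *.
have : 0 <= (rho * (INR a + INR w) - INR w) * (ln c1 - ln c0).
  by apply: Rmult_le_pos; lra.
by nra.
Qed.

(** The inequality [exp y >= 1 + y] at [y = - ln (1 + g)] gives [ln (1 + g) >= 1 - 1 / (1 + g)]. *)
Lemma ln_lower (g : R) : 0 <= g -> g - g * g <= ln (1 + g).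
Proof.
move=> g0.
have h := exp_ineq1_le (- ln (1 + g)).
rewrite exp_Ropp exp_ln in h; last lra.
have : / (1 + g) <= 1 - g + g * g.
  apply: (Rmult_le_reg_l (1 + g)); first lra.
  by rewrite Rinv_r; nra.
lra.
Qed.

(** Per coordinate the logarithm is at most [g (1 - rho - g) - (1 - rho) (g - g^2) = - rho g^2]. *)
Lemma moment_ratio (rho g : R) (n : nat) : 0 < rho < 1 -> 0 <= g <= 1 - rho ->
  (1 + g * (1 - rho - g)) ^ n / exp (INR n * ((1 - rho) * ln (1 + g)))
    <= exp (- (rho * g ^ 2 * INR n)).
Proof.
move=> rho01 g0; have g_ge : 0 <= g * (1 - rho - g) by apply: Rmult_le_pos; lra.
rewrite pow_exp; last lra.
rewrite /Rdiv -exp_Ropp -exp_plus; apply: exp_le.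
have h1 : ln (1 + g * (1 - rho - g)) <= g * (1 - rho - g).
  have := exp_ineq1_le (ln (1 + g * (1 - rho - g))); rewrite exp_ln; lra.
have h2 := @ln_lower g (proj1 g0).
have n0 := pos_INR n.
have : ln (1 + g * (1 - rho - g)) - (1 - rho) * ln (1 + g) <= - (rho * g ^ 2) by nra.
nra.
Qed.

Section FixedFamily.
Variables (F : finFieldType) (n M d t0 N l : nat) (T : 'I_n -> {set F}) (rho : R).
Hypothesis card_T : forall k, #|T k| = l.
Hypotheses (l_gt0 : (0 < l)%N) (l_lt : (l < #|F|)%N).
Hypotheses (rho_gt0 : 0 < rho) (rho_lt : rho < 1 - INR l / INR #|F|).

Let q := INR #|F|.
(** [g] has two roles: it is the guaranteed drop in the probability that a sum of two fresh symbols
    falls in [T k], and it is the tilt used in [phi]. *)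
Let g := rho * (1 - INR l / q - rho).
Let h := hql #|F| l rho.
Let p0 := rho / (q - INR l).
Let p1 := (1 - rho) / INR l.

Let l0 : 0 < INR l. Proof. exact/lt_0_INR/ssrnat.ltP. Qed.
Let lq : INR l < q. Proof. exact/lt_INR/ssrnat.ltP. Qed.
Let q0 : 0 < q. Proof. lra. Qed.
Let lq_bounds : 0 < INR l / q < 1.
Proof.
split; first exact: Rdiv_lt_0_compat.
by apply: (Rmult_lt_reg_r q) => //; rewrite /Rdiv Rmult_assoc Rinv_l; lra.
Qed.
Let rho_ltq : rho < 1 - INR l / q. Proof. exact: rho_lt. Qed.
Let p0_gt0 : 0 < p0.
Proof. apply: Rdiv_lt_0_compat; lra. Qed.
Let ltp : p0 < p1.
Proof.
have e : INR l = INR l / q * q by field; lra.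
apply: (Rmult_lt_reg_r ((q - INR l) * INR l)); first by apply: Rmult_lt_0_compat; lra.
have -> : p0 * ((q - INR l) * INR l) = rho * INR l by rewrite /p0; field; lra.
have -> : p1 * ((q - INR l) * INR l) = (1 - rho) * (q - INR l).
  by rewrite /p1; field; lra.
suff : rho * q < q - INR l by nra.
have : rho * q < (1 - INR l / q) * q by apply: Rmult_lt_compat_r.
by rewrite Rmult_minus_distr_r -e; lra.
Qed.

(** The weights are chosen for this: a point with exactly [rho * n] misses has mass [q ^ (- h n)],
    which is thus a lower bound on the whole ball. *)
Lemma hql_weights : (1 - rho) * ln p1 + rho * ln p0 = - (h * ln q).
Proof.
have lnq : 0 < ln q.
  rewrite -ln_1; apply: ln_increasing; first lra.
  have -> : 1 = INR 1 by [].
  by apply: lt_INR; apply/ssrnat.ltP; apply: leq_ltn_trans l_lt.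
have e1 : p1 = / (INR l / (1 - rho)) by rewrite /p1; field; split; lra.
have e0 : p0 = / ((q - INR l) / rho) by rewrite /p0; field; split; lra.
rewrite e1 e0 !ln_Rinv; try (apply: Rdiv_lt_0_compat; lra).
rewrite /h /hql /logb -/q; field; repeat split; lra.
Qed.

Lemma card_bad_fixed_family :
  h * INR n <= INR M -> (#|F| ^ (2 * d) * (#|F| * t0 + 2) <= N)%N ->
  INR #|[set H : 'M[F]_(M, n) | (N < #|[set x in lr_ball rho T | (H *m x == 0)%R]|)%N]|
   <= q ^ (M * n) * (Rpower q (- ((INR M - h * INR n) * INR t0)) +
        INR t0 * (Rpower q (INR t0 * INR d + INR n) * exp (- (g ^ 3 * INR n * INR d)))).
Proof.
move=> leM leN.
pose B : {set 'rV[F]_n} := [set x | (x^T)%R \in lr_ball rho T].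
pose zeta := exp (INR n * ((1 - rho) * ln (1 + g))).
pose kappa := 1 + g * (1 - rho - g).
pose beta := Rpower q (- (h * INR n)).
have g0 : 0 < g by apply: Rmult_lt_0_compat; lra.
have grho : g <= rho by rewrite /g; nra.
have g1rho : g <= 1 - rho by rewrite /g; nra.
have kappa0 : 0 <= kappa.
  by have : 0 <= g * (1 - rho - g) by [apply: Rmult_le_pos; lra]; rewrite /kappa; lra.
have setE H : #|[set x in lr_ball rho T | (H *m x == 0)%R]| =
    #|[set x in B | ((H : 'M[F]_(M, n)) *m x^T == 0)%R]|.
  rewrite -(card_imset _ (can_inj (@trmxK F n 1))); apply: eq_card => x.
  apply/imsetP/idP => [[y]|].
    by rewrite !inE => /andP [yB Hy] ->; rewrite trmxK yB Hy.
  by rewrite !inE => /andP [xB Hx]; exists (x^T)%R; rewrite ?trmxK // !inE xB Hx.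
pose p k a := if a \in T k then p1 else p0.
pose phi k a := if a \in T k then 1 + g else 1.
have total k : (#|T k|%:R * p1 + (#|F|%:R - #|T k|%:R) * p0 = 1)%R.
  have tot : INR l * p1 + (q - INR l) * p0 = 1 by rewrite /p1 /p0; field; split; lra.
  by rewrite card_T -!INRE; exact: tot.
have p0_ge0 : 0 <= p0 by lra.
have p1_ge0 : 0 <= p1 by lra.
have p01 : p0 <= p1 by lra.
have g_ge0 : 0 <= g by lra.
have g1_ge0 : 0 <= 1 + g by lra.
have R1_ge0 : 0 <= 1 by lra.
have p_ge0 k a : (0 <= p k a)%R by rewrite /p; case: ifP => _; apply/RleP.
have p_sum k : (\sum_a p k a = 1)%R by apply: sum_two_valued (total k).
have phi_ge0 k a : (0 <= phi k a)%R by rewrite /phi; case: ifP => _; apply/RleP.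
have two k (al be z : F) : (al != 0 -> be != 0 ->
    \sum_a p k a * \sum_b p k b * phi k (al * a + be * b + z) <= kappa)%R.
  move=> al0 be0; apply: le_trans (two_coordinates_moment _ _ _ (total k) z al0 be0) _.
  - exact/RleP.
  - exact/RleP.
  - exact/RleP.
  apply/RleP; rewrite card_T -!INRE -?RminusE -?RmultE -?RplusE -?RmultE.
  rewrite /kappa; apply: Rplus_le_compat_l; apply: Rmult_le_compat_l; first lra.
  (* This probability bound is [1 - rho - rho * (1 - l/q - rho) / (1 - l/q)]; bounding the
     denominator by [1] leaves [1 - rho - g]. *)
  have -> : INR l * (p0 + (p1 - p0) * (INR l * p1)) =
      1 - rho - rho * (1 - rho - rho * INR l / (q - INR l)).
    by rewrite /p1 /p0; field; split; lra.
  have -> : 1 - rho - rho * INR l / (q - INR l) =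
      (1 - INR l / q - rho) * / (1 - INR l / q).
    by field; repeat split; lra.
  suff : 1 - INR l / q - rho <= (1 - INR l / q - rho) * / (1 - INR l / q).
    by rewrite /g; nra.
  rewrite -{1}[1 - INR l / q - rho]Rmult_1_r; apply: Rmult_le_compat_l; first lra.
  by rewrite -{1}Rinv_1; apply: Rinv_le_contravar; lra.
have beta_gt0 : (0 < beta)%R by apply/RltP; apply: exp_pos.
have zeta_gt0 : (0 < zeta)%R by apply/RltP; apply: exp_pos.
have beta_le (x : 'rV[F]_n) : x \in B -> (beta <= \prod_k p k (x 0 k))%R.
  rewrite inE => /(lr_ball_prod_lower (conj p0_gt0 (Rlt_le _ _ ltp))).
  rewrite hql_weights /beta /Rpower => le_prod; apply/RleP.
  apply: Rle_trans (Rle_trans _ _ _ _ le_prod) _.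
    by apply: exp_le; apply: Req_le; ring.
  by apply: Req_le; apply: eq_bigr => k _; rewrite mxE.
have zeta_le (x : 'rV[F]_n) : x \in B -> (zeta <= \prod_k phi k (x 0 k))%R.
  have g1 : 0 < 1 <= 1 + g by lra.
  rewrite inE => /(lr_ball_prod_lower g1).
  rewrite ln_1 Rmult_0_r Rplus_0_r -/zeta => le_prod; apply/RleP.
  apply: Rle_trans le_prod _.
  by apply: Req_le; apply: eq_bigr => k _; rewrite mxE.
have qMb : (#|F|%:R ^+ M * beta)%R = Rpower q (INR M - h * INR n).
  by rewrite -INRE -RpowE -/q -RmultE -Rpower_pow // /beta -Rpower_plus.
have lnq : 0 < ln q.
  rewrite -ln_1; apply: ln_increasing; first lra.
  have -> : 1 = INR 1 by [].
  by apply: lt_INR; apply/ssrnat.ltP; apply: leq_ltn_trans l_lt.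
have ge1 : (1 <= #|F|%:R ^+ M * beta)%R.
  have : 1 <= Rpower q (INR M - h * INR n).
    by rewrite /Rpower -[1]exp_0; apply: exp_le; apply: Rmult_le_pos; lra.
  by rewrite qMb => ?; apply/RleP.
have /RleP := @card_bad_matrices F R n M d t0 N B p phi beta zeta kappa p_ge0 p_sum
  phi_ge0 two (introT RleP kappa0) beta_gt0 zeta_gt0 beta_le zeta_le ge1 leN.
rewrite qMb -!INRE -!RpowE -?RinvE -?RmultE -?RplusE -/q => main.
rewrite (eq_card (B := mem [set H : 'M[F]_(M, n) |
  (N < #|[set x in B | (H *m x^T == 0)%R]|)%N])); last first.
  by move=> H; rewrite !inE setE.
apply: Rle_trans main _.
apply: Rmult_le_compat_l; first by apply: pow_le; lra.
apply: Rplus_le_compat.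
  apply: Req_le; rewrite -Rpower_pow; last exact: exp_pos.
  by rewrite Rpower_mult Rpower_Ropp.
apply: Rmult_le_compat_l; first exact: pos_INR.
have -> : q ^ (t0 * d) * q ^ n = Rpower q (INR t0 * INR d + INR n).
  by rewrite Rpower_plus -mult_INR !Rpower_pow.
apply: Rmult_le_compat_l; first by apply: Rlt_le; apply: exp_pos.
have ratio := @moment_ratio rho g n (conj rho_gt0 (_ : rho < 1)) (conj (Rlt_le _ _ g0) g1rho).
have {}ratio : kappa ^ n * / zeta <= exp (- (rho * g ^ 2 * INR n)) by apply: ratio; lra.
apply: Rle_trans (pow_incr _ _ d (conj _ ratio)) _.
  apply: Rmult_le_pos; first exact: pow_le.
  by apply: Rlt_le; apply: Rinv_0_lt_compat; apply: exp_pos.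
rewrite pow_exp; last exact: exp_pos.
rewrite ln_exp; apply: exp_le.
have n0 := pos_INR n; have d0 := pos_INR d.
(* As [g <= rho], the rate [rho * g ^ 2] is at least [g ^ 3]. *)
have : 0 <= (rho - g) * (g ^ 2 * (INR n * INR d)).
  apply: Rmult_le_pos; first lra.
  by apply: Rmult_le_pos; [apply: pow2_ge_0|apply: Rmult_le_pos].
by nra.
Qed.

End FixedFamily.

(** * Union over all families of lists *)

Lemma expn_INR (a b : nat) : INR (a ^ b) = INR a ^ b.
Proof. by rewrite RpowE !INRE natrX. Qed.

Lemma muln_INR (a b : nat) : INR (a * b) = INR a * INR b.
Proof. exact: mult_INR. Qed.

Lemma leq_INR (a b : nat) : (a <= b)%N -> INR a <= INR b.
Proof. by move/ssrnat.leP/le_INR. Qed.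

Definition size_l_balls (F : finFieldType) (n l : nat) (rho : R)
  : {set {set 'cV[F]_n}} :=
  (fun T : {ffun 'I_n -> {set F}} => lr_ball rho T) @:
    [set T : {ffun 'I_n -> {set F}} | [forall i, #|T i| == l]].

Lemma card_bad_size_l_balls (F : finFieldType) (n M N l : nat) (rho c : R) :
  (forall T : {ffun 'I_n -> {set F}}, (forall i, #|T i| = l) ->
    INR #|[set H : 'M[F]_(M, n) |
       (N < #|[set x in lr_ball rho T | (H *m x == 0)%R]|)%N]| <= c) ->
  0 <= c ->
  INR #|bad_matrices (size_l_balls F n l rho) M N| <= INR #|F| ^ (l * n) * c.
Proof.
move=> le_c c0; set Ts := [set T : {ffun 'I_n -> {set F}} | [forall i, #|T i| == l]].
pose D (T : {ffun 'I_n -> {set F}}) := [set H : 'M[F]_(M, n) |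
  (N < #|[set x in lr_ball rho T | (H *m x == 0)%R]|)%N].
have cover : (#|bad_matrices (size_l_balls F n l rho) M N| <= \sum_(T in Ts) #|D T|)%N.
  apply: card_le_sum_cover_in => H; rewrite inE => /exists_inP [X /imsetP [T TT ->] ltN].
  by exists T; rewrite // inE.
apply: Rle_trans (leq_INR cover) _.
apply: (@Rle_trans _ (INR #|Ts| * c)); last first.
  apply: Rmult_le_compat_r => //; rewrite -expn_INR.
  by apply/leq_INR/card_fixed_size_families.
have le_D : (\sum_(T in Ts) (INR #|D T| : R) <= \sum_(T in Ts) (c : R))%R.
  apply: ler_sum => T; rewrite inE => /forallP cT; apply/RleP; apply: le_c => i.
  exact/eqP.
move/RleP: le_D; rewrite sumr_const -mulr_natl -INRE.
have -> // : INR (\sum_(T in Ts) #|D T|)%N = (\sum_(T in Ts) (INR #|D T| : R))%R.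
by rewrite INRE natr_sum; apply: eq_bigr => T _; rewrite INRE.
Qed.

Lemma not_bad_list_recoverable (F : finFieldType) (n m N l : nat) (rho L : R)
    (H : 'M[F]_(m, n)) :
  (l <= #|F|)%N -> INR N <= L ->
  H \notin bad_matrices (size_l_balls F n l rho) m N ->
  list_recoverable (kernel_code H) rho l L.
Proof.
move=> lF leL notbad T cT; apply: Rle_trans leL; apply: leq_INR.
have /fin_all_exists [T' T'P] : forall i, exists A : {set F}, T i \subset A /\ #|A| = l.
  move=> i; have [|A sub cA] := @superset_of_size F (T i) l; first by rewrite cT lF.
  by exists A.
pose T'f := [ffun i => T' i]; rewrite leqNgt; apply: contra notbad => ltN.
rewrite inE; apply/exists_inP; exists (lr_ball rho T'f).
  apply/imsetP; exists T'f => //; rewrite inE; apply/forallP=> i.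
  by rewrite ffunE (proj2 (T'P i)).
apply: leq_trans ltN _; apply/subset_leq_card/subsetP=> x.
rewrite !inE => /andP [-> /Defs_RlebP xT]; rewrite andbT; apply/Defs_RlebP.
apply: Rle_trans xT; apply/leq_INR/subset_leq_card/subsetP=> i; rewrite !inE ffunE.
by apply: contra; apply: subsetP; exact: (proj1 (T'P i)).
Qed.

(** The union bound is taken for matrices with [m + s] rows; passing back to [m] rows multiplies
    both the list size and the failure probability by [2 * #|F| ^ s]. *)
Lemma most_matrices_list_recoverable (F : finFieldType) (n m s N l : nat)
    (rho L c : R) :
  (l <= #|F|)%N -> INR (2 * #|F| ^ s * N) <= L -> 0 <= c ->
  (forall T : {ffun 'I_n -> {set F}}, (forall i, #|T i| = l) ->
    INR #|[set H : 'M[F]_(m + s, n) |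
       (N < #|[set x in lr_ball rho T | (H *m x == 0)%R]|)%N]|
    <= INR #|F| ^ ((m + s) * n) * c) ->
  2 * INR #|F| ^ s * (INR #|F| ^ (l * n) * c) <= / INR #|F| ^ n ->
  exists G : {set 'M[F]_(m, n)},
    INR #|G| / INR #|{: 'M[F]_(m, n)}| >= 1 - / (INR #|F| ^ n) /\
    forall H, H \in G -> list_recoverable (kernel_code H) rho l L.
Proof.
move=> lF leL c0 le_c le_n.
set q := INR #|F|; have q0 : 0 < q.
  by apply: lt_0_INR; apply/ssrnat.ltP; apply/card_gt0P; exists 0%R.
pose bad := bad_matrices (size_l_balls F n l rho) m (2 * #|F| ^ s * N).
exists (~: bad); split; last first.
  by move=> H; rewrite inE; apply: not_bad_list_recoverable.
have qpow k : 0 < q ^ k by apply: pow_lt.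
have -> : INR #|~: bad| = INR #|{: 'M[F]_(m, n)}| - INR #|bad|.
  by rewrite -(cardsC bad) plus_INR; lra.
rewrite card_mx expn_INR -/q.
have -> : (q ^ (m * n) - INR #|bad|) / q ^ (m * n) = 1 - INR #|bad| / q ^ (m * n).
  by field; have := qpow (m * n)%N; lra.
apply: Rle_ge; apply: Rplus_le_compat_l; apply: Ropp_le_contravar.
apply: Rle_trans le_n.
have := leq_INR (card_bad_matrices_extend (size_l_balls F n l rho) m s N).
rewrite !muln_INR !expn_INR -/q -/bad => ext.
have cM : 0 <= q ^ ((m + s) * n) * c by apply: Rmult_le_pos => //; apply: Rlt_le.
have := card_bad_size_l_balls le_c cM; rewrite -/q => uni.
apply: (Rmult_le_reg_r (q ^ (m * n) * q ^ (s * n))); first exact: Rmult_lt_0_compat.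
have -> : INR #|bad| / q ^ (m * n) * (q ^ (m * n) * q ^ (s * n)) =
    INR #|bad| * q ^ (s * n).
  by field; have := qpow (m * n)%N; lra.
have INR2 : INR 2 = 2 by [].
rewrite INR2 in ext; apply: Rle_trans ext _.
have q2 : 0 <= 2 * q ^ s by have := qpow s; lra.
apply: Rle_trans (Rmult_le_compat_l _ _ _ q2 uni) _.
by apply: Req_le; rewrite mulnDl pow_add; ring.
Qed.

(** * Choice of the parameters *)

Lemma Rpower_le (q x y : R) : 1 <= q -> x <= y -> Rpower q x <= Rpower q y.
Proof.
move=> q1 xy; apply: exp_le; apply: Rmult_le_compat_r => //.
case: q1 => [q1|<-]; last by rewrite ln_1; lra.
by apply: Rlt_le; rewrite -ln_1; apply: ln_increasing; lra.
Qed.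

Lemma IZR_le_INR_to_nat (z : Z) : IZR z <= INR (Z.to_nat z).
Proof. by rewrite INR_IZR_INZ; apply: IZR_le; lia. Qed.

Lemma ceil_nat_ge (x : R) : x <= INR (ceil_nat x).
Proof.
apply: Rle_trans (IZR_le_INR_to_nat _); rewrite opp_IZR.
by have [h _] := base_Int_part (- x); lra.
Qed.

Lemma exists_nat_ceil (x : R) : 0 <= x -> exists k : nat, x <= INR k <= x + 1.
Proof.
move=> x0; have [up1 up2] := archimed x; exists (Z.to_nat (up x)).
have up0 : Z.le 0 (up x) by apply: le_IZR; lra.
by rewrite INR_IZR_INZ Z2Nat.id //; lra.
Qed.

(** Each chain step gains a factor [exp (- g ^ 3 n)], so [D] steps gain at least [q ^ n]. Taking [D]
    about [b ^ 3] works because [g ^ 3 * b ^ 3 = log2 q ^ 3 >= ln q]. *)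
Lemma exists_scale (q g : R) : 2 <= q -> 0 < g <= / 4 ->
  let b := log2 q / g in 4 <= b /\
  exists D : nat, [/\ ln q <= g ^ 3 * INR D, 64 <= b ^ 3 & b ^ 3 <= INR D <= b ^ 3 + 1].
Proof.
move=> q2 [g0 g4] b.
have ln2_gt0 : 0 < ln 2 by rewrite -ln_1; apply: ln_increasing; lra.
have ln2_lt1 : ln 2 < 1 
  by rewrite -[X in _ < X]ln_exp; apply: ln_increasing; [|have := @exp_ineq1 1]; lra.
have lnq : ln 2 <= ln q.
  by case: q2 => [h|<-]; [apply: Rlt_le; apply: ln_increasing; lra|lra].
have log_ge1 : 1 <= log2 q.
  by apply: (Rmult_le_reg_r (ln 2)) => //; rewrite /log2 /Rdiv Rmult_assoc Rinv_l; lra.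
have b_ge4 : 4 <= b.
  apply: (Rmult_le_reg_r g) => //.
  by rewrite /b /Rdiv Rmult_assoc Rinv_l; lra.
have b3 : 64 <= b ^ 3.
  have -> : 64 = 4 ^ 3 by ring.
  by apply: pow_incr; lra.
split=> //; have [|D [D1 D2]] := @exists_nat_ceil (b ^ 3); first lra.
exists D; split=> //.
have lnq_le : ln q <= log2 q.
  apply: (Rmult_le_reg_r (ln 2)) => //; rewrite /log2 /Rdiv Rmult_assoc Rinv_l; last lra.
  nra.
have gb : g ^ 3 * b ^ 3 = log2 q ^ 3 by rewrite /b; field; lra.
have g3 : 0 < g ^ 3 by apply: pow_lt.
have log3 : log2 q <= log2 q ^ 3.
  have : 1 <= log2 q ^ 2 by apply: pow_R1_Rle.
  by have -> : log2 q ^ 3 = log2 q * log2 q ^ 2 by [ring]; nra.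
nra.
Qed.

Section Numerics.
Variables (q l n D t0 : nat) (eps E g K : R).
Hypotheses (q2 : (2 <= q)%N) (l_gt0 : (0 < l)%N) (lq : (l <= q)%N).
Hypotheses (eps01 : 0 < eps < 1) (D_gt0 : (0 < D)%N).
Hypotheses (g3D : ln (INR q) <= g ^ 3 * INR D).
Hypotheses (nD : 24 * INR D <= INR n) (KD : 62 * INR D <= K).
(** The [d] chain steps gain [q ^ (16 l n)]. The [s] extra checks force [x <= n / (4 D)], so
    [t0 * d <= 8 l n] and choosing the chain costs at most half of that gain. The value of [x] makes
    [t0] independent points cost [q ^ (- 6 l n)]. *)
Let s := (24 * l * D)%N.
Let d := (16 * l * D)%N.
Let x := 6 * INR l * INR n / (eps * INR n + INR s).
Hypotheses (t0_bounds : x <= INR t0 <= x + 1).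
Hypothesis E_ge : eps * INR n + INR s <= E.

Let Q := INR q.
Let Q2 : 2 <= Q. Proof. by have := leq_INR q2; rewrite /Q /=; lra. Qed.
Let l1 : 1 <= INR l. Proof. by have := leq_INR l_gt0; rewrite /=; lra. Qed.
Let D1 : 1 <= INR D. Proof. by have := leq_INR D_gt0; rewrite /=; lra. Qed.
Let lQ : INR l <= Q. Proof. exact: leq_INR. Qed.
Let INR16 : INR 16 = 16. Proof. by rewrite /=; lra. Qed.
Let INR24 : INR 24 = 24. Proof. by rewrite /=; lra. Qed.
Let sE : INR s = 24 * INR l * INR D.
Proof. by rewrite /s !muln_INR INR24. Qed.
Let dE : INR d = 16 * INR l * INR D.
Proof. by rewrite /d !muln_INR INR16. Qed.
Let lD : 1 <= INR l * INR D. Proof. nra. Qed.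
Let en : 0 < eps * INR n + INR s.
Proof. by rewrite sE; have : 0 < eps * INR n by [apply: Rmult_lt_0_compat; lra]; nra. Qed.

(** Both failure terms are at most [q ^ (- 6 l n)]; for the second, the exponent is
    [n + 8 l n + n - 16 l n]. This pays for the [l n] of the union bound, for [s <= l n], for the
    constants and for the final [q ^ (- n)]. *)
Lemma failure_bound :
  2 * Q ^ s * (Q ^ (l * n) * (Rpower Q (- (E * INR t0)) +
     INR t0 * (Rpower Q (INR t0 * INR d + INR n) * exp (- (g ^ 3 * INR n * INR d)))))
  <= / Q ^ n.
Proof.
have Q1 : 1 <= Q by lra.
have Q0 : 0 < Q by lra.
have n24 : 24 <= INR n by lra.
have xe : x * (eps * INR n + INR s) = 6 * INR l * INR n by rewrite /x; field; lra.
have x_ge0 : 0 <= x.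
  by apply: Rlt_le; apply: Rdiv_lt_0_compat => //; do 2?apply: Rmult_lt_0_compat; lra.
have xs : x * (4 * INR D) <= INR n.
  have : x * INR s <= 6 * INR l * INR n.
    by rewrite -xe; apply: Rmult_le_compat_l => //; nra.
  rewrite sE => h; apply: (Rmult_le_reg_l (6 * INR l)); first lra.
  by apply: Rle_trans h; apply: Req_le; ring.
have t1 : Rpower Q (- (E * INR t0)) <= Rpower Q (- (6 * INR l * INR n)).
  apply: Rpower_le => //; apply: Ropp_le_contravar; rewrite -xe Rmult_comm.
  by apply: Rmult_le_compat; lra.
have t0n : INR t0 <= INR n by nra.
have n_le : INR n <= Rpower Q (INR n).
  rewrite Rpower_pow // /Q -expn_INR; apply: leq_INR; apply: ltnW.
  exact: ltn_expl.
have t0d : INR t0 * INR d <= 8 * INR l * INR n.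
  rewrite dE.
  have : INR t0 * (16 * INR D) <= 8 * INR n by nra.
  move=> h; have := Rmult_le_compat_l (INR l) _ _ _ h; nra.
have e1 : exp (- (g ^ 3 * INR n * INR d)) <= Rpower Q (- (16 * INR l * INR n)).
  apply: exp_le; rewrite dE.
  have := Rmult_le_compat_r (16 * INR l * INR n) _ _ _ g3D; rewrite -/Q => h.
  have : ln Q * (16 * INR l * INR n) <= g ^ 3 * INR D * (16 * INR l * INR n).
    by apply: h; apply: Rmult_le_pos; lra.
  lra.
have t2 : INR t0 * (Rpower Q (INR t0 * INR d + INR n) * exp (- (g ^ 3 * INR n * INR d)))
    <= Rpower Q (- (6 * INR l * INR n)).
  apply: (@Rle_trans _ (Rpower Q (INR n) * (Rpower Q (INR t0 * INR d + INR n) *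
     Rpower Q (- (16 * INR l * INR n))))).
    have P1 := exp_pos (- (g ^ 3 * INR n * INR d)).
    have P2 : 0 < Rpower Q (INR t0 * INR d + INR n) by apply: exp_pos.
    apply: Rmult_le_compat; [exact: pos_INR| |lra|].
      by apply: Rmult_le_pos; lra.
    by apply: Rmult_le_compat_l; lra.
  rewrite -!Rpower_plus; apply: Rpower_le => //; nra.
have -> : / Q ^ n = Rpower Q (- INR n) by rewrite -Rpower_pow // Rpower_Ropp.
apply: (@Rle_trans _ (2 * Q ^ s * (Q ^ (l * n) * (2 * Rpower Q (- (6 * INR l * INR n)))))).
  apply: Rmult_le_compat_l; first by have := pow_lt Q s Q0; lra.
  apply: Rmult_le_compat_l; first by apply: Rlt_le; apply: pow_lt.
  lra.
apply: (@Rle_trans _ (Q ^ 2 * Rpower Q (INR s + INR l * INR n - 6 * INR l * INR n))).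
  rewrite /Rminus !Rpower_plus -muln_INR !Rpower_pow //.
  have P : 0 < Q ^ s * (Q ^ (l * n) * Rpower Q (- (6 * INR l * INR n))).
    apply: Rmult_lt_0_compat; first exact: pow_lt.
    by apply: Rmult_lt_0_compat; [apply: pow_lt|apply: exp_pos].
  have Q4 : 4 <= Q ^ 2 by rewrite /=; nra.
  have := Rmult_le_compat_r _ _ _ (Rlt_le _ _ P) Q4.
  lra.
rewrite -(Rpower_pow 2) // -Rpower_plus; apply: Rpower_le => //; rewrite sE.
have -> : INR 2 = 2 by [].
nra.
Qed.

(** Dropping [s] from the denominator of [x] gives [t0 <= 6 l / eps + 1]. The exponent of [Q] is
    then at most [6 + s + 2 d = 6 + 56 l D], whence the constant [62]. *)
Lemma list_size_bound :
  INR (2 * q ^ s * (q ^ (2 * d) * (q * t0 + 2))) <= Rpower Q (INR l * K) * (1 / eps).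
Proof.
have Q1 : 1 <= Q by lra.
have Q0 : 0 < Q by lra.
have INR2 : INR 2 = 2 by [].
rewrite !muln_INR plus_INR !muln_INR !expn_INR INR2 -/Q.
have ieps : 1 <= 1 / eps.
  by apply: (Rmult_le_reg_r eps); [lra|rewrite /Rdiv Rmult_assoc Rinv_l; lra].
have xle : x <= 6 * INR l * (1 / eps).
  have -> : 6 * INR l * (1 / eps) = 6 * INR l * INR n / (eps * INR n).
    by field; split; lra.
  rewrite /x; apply: Rmult_le_compat_l; first by apply: Rmult_le_pos; lra.
  apply: Rinv_le_contravar; first by apply: Rmult_lt_0_compat; lra.
  by have := pos_INR s; lra.
have le8 : Q * INR t0 + 2 <= 8 * Q ^ 2 * (1 / eps).
  have t0le : INR t0 <= 6 * Q * (1 / eps) + 1.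
    have : INR l * (1 / eps) <= Q * (1 / eps) by apply: Rmult_le_compat_r; lra.
    lra.
  have h1 : Q * INR t0 <= Q * (6 * Q * (1 / eps) + 1) by apply: Rmult_le_compat_l; lra.
  have h2 : Q ^ 2 <= Q ^ 2 * (1 / eps).
    by rewrite -{1}[Q ^ 2]Rmult_1_r; apply: Rmult_le_compat_l => //; apply: pow2_ge_0.
  nra.
have P : 0 < Q ^ s * Q ^ (2 * d) by apply: Rmult_lt_0_compat; apply: pow_lt.
apply: (@Rle_trans _ (16 * Q ^ 2 * (Q ^ s * Q ^ (2 * d)) * (1 / eps))).
  have := Rmult_le_compat_l _ _ _ (Rlt_le _ _ P) le8; lra.
apply: Rmult_le_compat_r; first lra.
have Q16 : 16 * Q ^ 2 <= Q ^ 6.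
  have -> : Q ^ 6 = Q ^ 4 * Q ^ 2 by ring.
  apply: Rmult_le_compat_r; first exact: pow2_ge_0.
  by have -> : 16 = 2 ^ 4 by [ring]; apply: pow_incr; lra.
apply: (@Rle_trans _ (Q ^ 6 * (Q ^ s * Q ^ (2 * d)))).
  by apply: Rmult_le_compat_r => //; lra.
rewrite -(Rpower_pow 6) // -(Rpower_pow s) // -(Rpower_pow (2 * d)) // -!Rpower_plus.
apply: Rpower_le => //; rewrite (muln_INR 2 d) INR2 sE dE.
have -> : INR 6 = 6 by rewrite /=; lra.
have := Rmult_le_compat_l (INR l) _ _ _ KD; nra.
Qed.

End Numerics.

Theorem theorem4p7 :
  exists C : R, 0 < C /\
  forall (q l : nat) (rho : R),
    prime_power q -> (0 < l)%N -> (l < q)%N ->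
    0 < rho -> rho < 1 - INR l / INR q ->
    let K := Rpower (log2 (INR q) / (rho * (1 - INR l / INR q - rho))) C in
    exists Crlq : R, Crlq <= Rpower (INR q) (INR l * K) /\
    forall (F : finFieldType), #|F| = q ->
    forall (n : nat) (eps : R), 0 < eps < 1 ->
      K <= INR n ->
      let Rate := 1 - hql q l rho - eps in
      let m := ceil_nat ((1 - Rate) * INR n) in
      exists G : {set 'M[F]_(m, n)},
        INR #|G| / INR #|{: 'M[F]_(m, n)}| >= 1 - / (INR q ^ n) /\
        forall H, H \in G ->
          list_recoverable (kernel_code H) rho l (Crlq * (1 / eps)).
Proof.
(* The exponent must ensure [62 * D <= b ^ C], where [b >= 4] and [D <= b ^ 3 + 1]; [10] leaves
   ample room. *)
exists 10; split; first lra.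
move=> q l rho _ l_gt0 l_lt rho_gt0 rho_lt K.
exists (Rpower (INR q) (INR l * K)); split; first exact: Rle_refl.
pose g := rho * (1 - INR l / INR q - rho).
have KE : K = Rpower (log2 (INR q) / g) 10 by [].
move: K KE => K KE F qE n eps eps01 K_le_n Rate m; subst q.
have q2 : (2 <= #|F|)%N by apply: leq_trans l_lt.
have Q2 : 2 <= INR #|F| by have := leq_INR q2; rewrite /=; lra.
have lq_gt0 : 0 < INR l / INR #|F|.
  by apply: Rdiv_lt_0_compat; [apply: lt_0_INR; apply/ssrnat.ltP|lra].
have g_bounds : 0 < g <= / 4.
  split; first by apply: Rmult_lt_0_compat; lra.
  (* Here [g <= rho * (1 - rho) <= 1 / 4]. *)
  by have := pow2_ge_0 (rho - / 2); rewrite /g; nra.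
have [b_ge4 [D [g3D b3 [D_ge D_le]]]] := exists_scale Q2 g_bounds.
set b := log2 _ / g in KE b_ge4 b3 D_ge D_le.
have K_ge : 62 * INR D <= K.
  have -> : K = b ^ 3 * b ^ 7.
    rewrite KE (_ : 10 = INR 10); last by rewrite /=; lra.
    by rewrite Rpower_pow; [ring|lra].
  have : 4 ^ 7 <= b ^ 7 by apply: pow_incr; lra.
  nra.
have D_gt0 : (0 < D)%N.
  by apply/ssrnat.ltP; apply: INR_lt; rewrite /=; lra.
have n_gt0 : 0 < INR n by lra.
pose s := (24 * l * D)%N; pose d := (16 * l * D)%N.
pose x := 6 * INR l * INR n / (eps * INR n + INR s).
have [|t0 t0P] := @exists_nat_ceil x.
  apply: Rmult_le_pos; first by have := pos_INR l; nra.
  apply: Rlt_le; apply: Rinv_0_lt_compat; have := pos_INR s.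
  by have : 0 < eps * INR n by [apply: Rmult_lt_0_compat; lra]; lra.
have mP : (hql #|F| l rho + eps) * INR n <= INR m.
  have := ceil_nat_ge ((1 - Rate) * INR n); rewrite -/m /Rate; lra.
(* The extra checks keep the gap to the entropy at least [s], however small [eps] is. *)
have MP : eps * INR n + INR s <= INR (m + s) - hql #|F| l rho * INR n.
  by rewrite plus_INR; lra.
have en : 0 < eps * INR n + INR s.
  by have := pos_INR s; have : 0 < eps * INR n by [apply: Rmult_lt_0_compat; lra]; lra.
apply: (@most_matrices_list_recoverable F n m s
    (#|F| ^ (2 * d) * (#|F| * t0 + 2)) l rho _ _ (ltnW l_lt)
    _ _ (fun T cT => card_bad_fixed_family cT l_gt0 l_lt rho_gt0 rho_lt _ (leqnn _))).
- by apply: (list_size_bound q2 l_gt0 (ltnW l_lt) eps01 D_gt0 _ K_ge t0P); lra.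
- apply: Rplus_le_le_0_compat; first by apply: Rlt_le; apply: exp_pos.
  apply: Rmult_le_pos; first exact: pos_INR.
  by apply: Rlt_le; apply: Rmult_lt_0_compat; apply: exp_pos.
- by move=> T _; lra.
- by apply: (failure_bound q2 l_gt0 eps01 D_gt0 g3D _ t0P MP); lra.
Qed.
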